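(* Let $d_1,d_2,d_3,d_4\ge 1$ be integers, $d=\sum_{i=1}^4 d_i$, and let $T=\bigoplus_{i=1}^4\lambda_iI_{d_i}\in\mathbb{M}_d(\mathbb{C})$ with $\lambda_1,\lambda_2,\lambda_3,\lambda_4\in\mathbb{C}$ distinct. Then $\mathcal{U}(T)=\mathrm{Sym}_2(T)$.
   Context: A symmetry on $\mathbb{C}^d$ is an operator $J$ with $J=J^*=J^{-1}$; $\mathrm{Sym}_2(\mathbb{C}^d)$ is the set of products $J_1J_2$ of two symmetries. $\mathcal{U}(T)=\{U^*TU: U\text{ unitary on }\mathbb{C}^d\}$ and $\mathrm{Sym}_2(T)=\{W^*TW: W\in\mathrm{Sym}_2(\mathbb{C}^d)\}$. *)

(* Defs.v *)
From HB Require Import structures.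
From mathcomp Require Import all_boot all_order all_algebra.
From mathcomp Require Import sesquilinear spectral.
From mathcomp Require Import classical_sets reals.

Set Implicit Arguments.
Unset Strict Implicit.
Unset Printing Implicit Defensive.

Import Order.TTheory GRing.Theory Num.Theory.

Local Open Scope ring_scope.
Local Open Scope sesquilinear_scope.
Local Open Scope classical_set_scope.

Section Symmetries.

Context {C : numClosedFieldType} {n : nat}.

(* Invertibility must be stated: [invmx J] is [J] itself when [J] is singular. *)
Definition symmetry : set 'M[C]_n :=
  [set J | [/\ J \in unitmx, J = J^t* & J^t* = invmx J]].

Definition Sym2 : set 'M[C]_n :=
  [set J1 *m J2 | J1 in symmetry & J2 in symmetry].

Definition unitary_orbit (T : 'M[C]_n) : set 'M[C]_n :=
  [set U^t* *m T *m U | U in [set U : 'M[C]_n | U \is unitarymx]].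

Definition Sym2_orbit (T : 'M[C]_n) : set 'M[C]_n :=
  [set W^t* *m T *m W | W in Sym2].

End Symmetries.

(* Main.v *)
(** Every unitary [U] of size [m + n] factors as [D *m J] with [D] unitary and
    block diagonal and [J] a symmetry. Indeed, after multiplying [U] on both
    sides by block diagonal unitaries, a singular value decomposition makes its
    upper left block [Delta] diagonal and nonnegative; if [B] is the upper right
    block, then [J := [Delta, B; B^*, -K]] with [K := 1 - B^* (1 + Delta)^-1 B]
    is a symmetry with the same first block row as [U], so [U J] is block
    diagonal. Applying this to the splitting [(d1 + d2) + (d3 + d4)], and then
    within each of the two diagonal blocks, gives [U = D diag(K1, K2) J] with
    [D] commuting with [T] and [K1], [K2], [J] symmetries, whence
    [U^* T U = W^* T W] for [W := diag(K1, K2) J]. *)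

Require Import Defs.
From mathcomp Require Import all_boot all_order all_algebra.
From mathcomp Require Import sesquilinear spectral.
From mathcomp Require Import complex classical_sets reals.

Set Implicit Arguments.
Unset Strict Implicit.
Unset Printing Implicit Defensive.

Import Order.TTheory GRing.Theory Num.Theory.

Local Open Scope ring_scope.
Local Open Scope sesquilinear_scope.

Section Decomposition.

Context {C : numClosedFieldType}.

(** * Adjoints and block diagonal unitaries *)

Lemma mulmx_adj m n p (A : 'M[C]_(m, n)) (B : 'M[C]_(n, p)) :
  (A *m B)^t* = B^t* *m A^t*.
Proof. by rewrite trmx_mul map_mxM. Qed.

Lemma block_mx_adj m1 m2 n1 n2 (A : 'M[C]_(m1, n1)) (B : 'M[C]_(m1, n2))
    (D : 'M[C]_(m2, n1)) (E : 'M[C]_(m2, n2)) :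
  (block_mx A B D E)^t* = block_mx (A^t*) (D^t*) (B^t*) (E^t*).
Proof. by rewrite tr_block_mx map_block_mx. Qed.

Lemma unitarymx_adjP n {U : 'M[C]_n} :
  reflect (U^t* *m U = 1%:M) (U \is unitarymx).
Proof.
by rewrite -trmxC_unitary; apply: (iffP unitarymxP); rewrite trmxCK.
Qed.

Lemma block_diag_unitary m n (A : 'M[C]_m) (B : 'M[C]_n) :
  (block_mx A 0 0 B \is unitarymx) = (A \is unitarymx) && (B \is unitarymx).
Proof.
have -> : (block_mx A 0 0 B \is unitarymx) =
    (block_mx (A *m A^t*) 0 0 (B *m B^t*) == block_mx 1%:M 0 0 1%:M).
  rewrite qualifE /= block_mx_adj mulmx_block -scalar_mx_block.
  by rewrite !trmx0 !map_mx0 !mulmx0 !mul0mx !addr0 !add0r.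
apply/eqP/andP => [/eq_block_mx[hA _ _ hB]|[/unitarymxP-> /unitarymxP->]] //.
by split; apply/unitarymxP.
Qed.

(** * Singular value decomposition *)

(** Gram-Schmidt on the matrix whose rows all equal [w] produces a unit first row whose span
    contains [w], with nonnegative coefficient. The case [w = 0] is included, with [c = 0]. *)
Lemma unitarymx_row0 n (w : 'rV[C]_n.+1) :
  exists O c, [/\ O \is unitarymx, 0 <= c & w = c *: row 0 (O : 'M[C]_n.+1)].
Proof.
pose A : 'M[C]_n.+1 := \matrix_i w; pose O := schmidt A.
have O_unitary : O \is unitarymx by exact: schmidt_unitarymx.
have := row_schmidt_sub A 0; rewrite (big_pred1 ord0) => [|k]; last first.
  by rewrite leqn0.
rewrite genmxE rowK => /sub_rVP[c wE].
exists O, c; split=> //; have := form1_row_schmidt A 0.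
rewrite rowK wE -/O dotmxE -scalemxAl mxE -dotmxE (row_unitarymxP O_unitary).
by rewrite eqxx mulr1.
Qed.

(** Induction on [n]: unit rows [v], [o] with [v A = c o] and [o A^* = c v], completed to unitaries,
    split off a 1 by 1 block [c]; the induction hypothesis treats the other block. *)
Lemma singular_value_decomposition n (A : 'M[C]_n) :
  exists (V O : 'M[C]_n) (delta : 'rV_n), [/\ V \is unitarymx, O \is unitarymx,
    forall i, 0 <= delta 0 i & V *m A *m O^t* = diag_mx delta].
Proof.
elim: n A => [|n IHn] A.
  exists 1%:M, 1%:M, 0; split; try by apply/unitarymxP; apply/matrixP => - [].
    by case.
  by apply/matrixP => - [].
(* The first left singular vector is a unit eigenvector of [A *m A^t*]. *)
have [a /eigenvalueP[v0 v0E v0_neq0]] := @eigenvalue_closed C _ (A *m A^t*) isT.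
have [V [b [V_unitary b_ge0 v0V]]] := unitarymx_row0 v0.
have b_neq0 : b != 0 by apply: contraNneq v0_neq0 => b0; rewrite v0V b0 scale0r.
have vE : row 0 V *m (A *m A^t*) = a *: row 0 V.
  by apply: (scalerI b_neq0); rewrite scalemxAl -v0V v0E v0V !scalerA mulrC.
have row_dot (O : 'M[C]_n.+1) : O \is unitarymx ->
    row 0 O *m O^t* = delta_mx 0 0.
  by move=> /unitarymxP OO; rewrite -row_mul OO row1.
have [O [c [O_unitary c_ge0 cE cE']]] :
    exists (O : 'M[C]_n.+1) (c : C), [/\ O \is unitarymx, 0 <= c,
      row 0 V *m A = c *: row 0 O &
      row 0 O *m A^t* = c *: row 0 V].
  have [O [c [O_unitary c_ge0 cE]]] := unitarymx_row0 (row 0 V *m A).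
  (* For [c != 0], the eigenvector equation makes [o A^*] a multiple of [v]; taking the adjoint of
     [v A o^* = c] shows that the factor is [c], which is real. *)
  have [c0|c_neq0] := eqVneq c 0; last first.
    exists O, c; split=> //.
    have wA : row 0 O *m A^t* = (c^-1 * a) *: row 0 V.
      apply: (scalerI c_neq0); rewrite scalemxAl -cE -mulmxA vE scalerA.
      by rewrite mulrA divff // mul1r.
    suff <- : c^-1 * a = c by [].
    have vO : row 0 V *m A *m (row 0 O)^t* = c%:M.
      rewrite cE -scalemxAl -scalemx1; congr (_ *: _).
      by rewrite [LHS]mx11_scalar -dotmxE (row_unitarymxP O_unitary) eqxx.
    have := congr1 (fun M => M^t*) vO; rewrite !mulmx_adj trmxCK mulmxA wA.
    rewrite -scalemxAl => /matrixP/(_ 0 0).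
    rewrite mxE -dotmxE (row_unitarymxP V_unitary) eqxx mulr1 => ->.
    by rewrite !mxE eqxx mulr1n geC0_conj.
  (* For [c = 0], [A] is singular, hence so is its adjoint, and a normalised [w] with [w A^* = 0]
     serves as [o]. *)
  move: cE; rewrite c0 scale0r => vA0.
  have : ~~ row_free (A^t*).
    rewrite /row_free mxrank_map mxrank_tr -/(row_free A).
    apply/negP => A_free; have := mulmx_free_eq0 (row 0 V) A_free.
    rewrite vA0 eqxx => /esym/eqP rV0.
    have := row_dot _ V_unitary; rewrite rV0 mul0mx => /matrixP/(_ 0 0)/eqP.
    by rewrite !mxE eqxx eq_sym oner_eq0.
  rewrite -kermx_eq0 => /rowV0Pn[w /sub_kermxP wA w_neq0].
  have [O' [e [O'_unitary _ wO]]] := unitarymx_row0 w.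
  have e_neq0 : e != 0 by apply: contraNneq w_neq0 => e0; rewrite wO e0 scale0r.
  exists O', 0; split; rewrite ?scale0r //.
  by apply: (scalerI e_neq0); rewrite scalemxAl -wO wA scaler0.
have [M MD] : exists M : 'M[C]_(1 + n), V *m A *m O^t* = M by eexists.
have M0 : row 0 M = c *: delta_mx 0 0.
  by rewrite -MD !row_mul cE -scalemxAl row_dot.
have M0' : row 0 (M^t*) = c *: delta_mx 0 0.
  by rewrite -MD !mulmx_adj trmxCK row_mul mulmxA cE' -scalemxAl row_dot.
(* The first rows of [M] and of its adjoint both vanish off the corner, so [M] is block diagonal. *)
have ME : M = block_mx c%:M 0 0 (drsubmx M).
  rewrite -[LHS]submxK; congr block_mx; apply/matrixP => i j; rewrite !mxE !ord1.
  - have /matrixP/(_ 0 0) := M0; rewrite !mxE /= mulr1 mulr1n => <-.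
    by congr (M _ _); apply: val_inj.
  - have /matrixP/(_ 0 (rshift 1 j)) := M0; rewrite !mxE /= mulr0 => <-.
    by congr (M _ _); apply: val_inj.
  - have /matrixP/(_ 0 (rshift 1 i)) := M0'; rewrite !mxE /= mulr0 => /eqP.
    rewrite conjC_eq0 => /eqP <-.
    by congr (M _ _); apply: val_inj.
have [V' [O' [d [V'_unitary O'_unitary d_ge0 dE]]]] := IHn (drsubmx M).
have unitary1 (W : 'M[C]_n) :
    W \is unitarymx -> (block_mx 1%:M 0 0 W : 'M_(1 + n)) \is unitarymx.
  move=> W_unitary; rewrite block_diag_unitary W_unitary andbT.
  by apply/unitarymxP; rewrite mul1mx trmx1 map_mx1.
have d1_ge0 (i : 'I_(1 + n)) : 0 <= (row_mx c%:M d : 'rV_(1 + n)) 0 i.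
  by case: (split_ordP i) => j ->; rewrite ?row_mxEl ?row_mxEr // ord1 mxE eqxx.
have diagE : block_mx 1%:M 0 0 V' *m M *m (block_mx 1%:M 0 0 O')^t* =
    diag_mx (row_mx c%:M d).
  rewrite ME block_mx_adj trmx1 map_mx1 !trmx0 !map_mx0 !mulmx_block diag_mx_row.
  rewrite !(mulmx0, mul0mx, mulmx1, mul1mx, addr0, add0r) dE; congr block_mx.
  by apply/matrixP => i j; rewrite !mxE !ord1.
exists (block_mx 1%:M 0 0 V' *m (V : 'M_(1 + n))).
exists (block_mx 1%:M 0 0 O' *m (O : 'M_(1 + n))).
exists (row_mx c%:M d); split.
- exact: mul_unitarymx (unitary1 _ _) _.
- exact: mul_unitarymx (unitary1 _ _) _.
- exact: d1_ge0.
- by rewrite -diagE -MD mulmx_adj !mulmxA.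
Qed.

(** * Symmetries and the factorisation of unitaries *)

Lemma symmetryI n (J : 'M[C]_n) : J^t* = J -> J *m J = 1%:M -> symmetry J.
Proof.
move=> J_adj JJ; have /unitarymx_unit J_unit : J \is unitarymx.
  by apply/unitarymxP; rewrite J_adj.
split; rewrite ?J_adj //.
by rewrite -[invmx J]mul1mx -JJ mulmxK.
Qed.

Lemma symmetry_adj n (J : 'M[C]_n) : symmetry J -> J^t* = J.
Proof. by case. Qed.

Lemma symmetry_mul n (J : 'M[C]_n) : symmetry J -> J *m J = 1%:M.
Proof. by case=> J_unit JE JV; rewrite {2}JE JV mulmxV. Qed.

Lemma symmetry_unitary n (J : 'M[C]_n) : symmetry J -> J \is unitarymx.
Proof.
by move=> J_sym; apply/unitarymxP; rewrite symmetry_adj ?symmetry_mul.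
Qed.

Lemma symmetry_conj n (J V : 'M[C]_n) :
  V \is unitarymx -> symmetry J -> symmetry (V^t* *m J *m V).
Proof.
move=> V_unitary J_sym; apply: symmetryI.
  by rewrite !mulmx_adj trmxCK (symmetry_adj J_sym) mulmxA.
rewrite !mulmxA mulmxtVK // -[_ *m J *m J]mulmxA symmetry_mul // mulmx1.
exact/unitarymx_adjP.
Qed.

Lemma symmetry_block_diag m n (J : 'M[C]_m) (K : 'M[C]_n) :
  symmetry J -> symmetry K -> symmetry (block_mx J 0 0 K).
Proof.
move=> J_sym K_sym; apply: symmetryI.
  by rewrite block_mx_adj !trmx0 !map_mx0 !symmetry_adj.
rewrite mulmx_block scalar_mx_block !mulmx0 !mul0mx !addr0 add0r.
by rewrite !symmetry_mul.
Qed.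

Lemma unitary_diag_block_symmetry m n (U : 'M[C]_(m + n)) (delta : 'rV[C]_m) :
    U \is unitarymx -> ulsubmx U = diag_mx delta ->
    (forall i, 0 <= delta 0 i) ->
  exists X J, [/\ X \is unitarymx, symmetry J & U = block_mx 1%:M 0 0 X *m J].
Proof.
move=> U_unitary ulU delta_ge0.
pose D := diag_mx delta; pose B := ursubmx U.
(* [F] is a true inverse of [1 + D], as the entries of [delta] are nonnegative. *)
pose F : 'M[C]_m := diag_mx (\row_i (1 + delta 0 i)^-1).
have D_adj : D^t* = D.
  rewrite tr_diag_mx map_diag_mx; congr diag_mx; apply/rowP => i.
  by rewrite mxE /= geC0_conj.
have F_adj : F^t* = F.
  rewrite tr_diag_mx map_diag_mx; congr diag_mx; apply/rowP => i.
  by rewrite 2!mxE /= geC0_conj // invr_ge0 addr_ge0.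
have BB : B *m B^t* = 1%:M - D *m D.
  have := unitarymxP U_unitary.
  rewrite -[U]submxK ulU -/D -/B block_mx_adj D_adj mulmx_block scalar_mx_block.
  by case/eq_block_mx => <- _ _ _; rewrite addrC addKr.
have DF : F + F *m D = 1%:M.
  rewrite -[F in F + _]mulmx1 -mulmxDr -diag_const_mx -raddfD mulmx_diag.
  congr diag_mx; apply/rowP => i; rewrite !mxE mulVf // gt_eqF //.
  by rewrite ltr_wpDr.
have FD : (1%:M - D *m D) *m F = 1%:M - D.
  have -> : 1%:M - D *m D = (1%:M - D) *m (1%:M + D).
    by rewrite mulmxBl !mulmxDr !mul1mx mulmx1 opprD addrA addrK.
  suff -> : (1%:M - D) *m (1%:M + D) *m F = (1%:M - D) *m (F + F *m D).
    by rewrite DF mulmx1.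
  by rewrite -mulmxA (mulmxDl 1%:M D) mul1mx [D *m F]diag_mxC.
pose K := 1%:M - B^t* *m F *m B.
have K_adj : K^t* = K.
  rewrite linearB map_mxB /= trmx1 map_mx1 !mulmx_adj trmxCK F_adj.
  by rewrite mulmxA.
(* Together with [BB], the identities for [B K], [K B^*] and [K K] are the four blocks of
   [J J = 1]. *)
have BK : B *m K = D *m B.
  by rewrite mulmxBr mulmx1 !mulmxA BB FD mulmxBl mul1mx opprB addrCA subrr addr0.
have KB : K *m B^t* = B^t* *m D.
  by rewrite -{1}K_adj -mulmx_adj BK mulmx_adj D_adj.
have KK : K *m K = 1%:M - B^t* *m B.
  rewrite -[LHS]/((1%:M - B^t* *m F *m B) *m K) mulmxBl mul1mx.
  rewrite -[_ *m B *m K]mulmxA BK mulmxA -[_ *m F *m D]mulmxA.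
  by rewrite /K -addrA -opprD -mulmxDl -mulmxDr DF mulmx1.
pose J := block_mx D B (B^t*) (- K).
have J_adj : J^t* = J.
  by rewrite block_mx_adj D_adj trmxCK linearN map_mxN K_adj.
have JJ : J *m J = 1%:M.
  rewrite mulmx_block !mulmxN !mulNmx opprK BB BK KB KK !subrr.
  by rewrite addrC subrK addrC subrK scalar_mx_block.
have J_sym := symmetryI J_adj JJ.
pose X := drsubmx (U *m J).
(* [U] and [J] share the first block row [(D, B)], so that of [U J] is the first block row of
   [J J = 1]. *)
have UJ : U *m J = block_mx 1%:M 0 (dlsubmx (U *m J)) X.
  rewrite -[LHS]submxK; congr (block_mx _ _ _ _);
  rewrite -[U]submxK ulU -/D -/B mulmx_block ?block_mxKul ?block_mxKur.
    by rewrite BB addrC subrK.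
  by rewrite mulmxN BK subrr.
have UJ_unitary : U *m J \is unitarymx.
  exact: mul_unitarymx (symmetry_unitary _).
(* Orthogonality of the two block rows of [U J] kills its lower left block. *)
have dlUJ : dlsubmx (U *m J) = 0.
  have := unitarymxP UJ_unitary.
  rewrite {1 2}UJ block_mx_adj mulmx_block scalar_mx_block.
  case/eq_block_mx => _ _ + _; rewrite trmx0 trmx1 map_mx0 map_mx1.
  by rewrite mulmx0 mulmx1 addr0.
rewrite dlUJ in UJ; exists X, J; split=> //.
  by move: UJ_unitary; rewrite UJ block_diag_unitary => /andP[].
by rewrite -UJ -mulmxA JJ mulmx1.
Qed.

Lemma unitary_block_diag_symmetry m n (U : 'M[C]_(m + n)) :
    U \is unitarymx ->
  exists A B J, [/\ A \is unitarymx, B \is unitarymx, symmetry J &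
    U = block_mx A 0 0 B *m J].
Proof.
move=> U_unitary.
have [V [O [delta [V_unitary O_unitary delta_ge0 svd]]]] :=
  singular_value_decomposition (ulsubmx U).
have unitary1 (W : 'M[C]_m) : W \is unitarymx ->
    block_mx W 0 0 (1%:M : 'M_n) \is unitarymx.
  move=> W_unitary; rewrite block_diag_unitary W_unitary.
  by apply/unitarymxP; rewrite mul1mx trmx1 map_mx1.
pose V1 := block_mx V 0 0 (1%:M : 'M_n).
pose O1 := block_mx O 0 0 (1%:M : 'M_n).
have V1_unitary : V1 \is unitarymx by exact: unitary1.
have O1_unitary : O1 \is unitarymx by exact: unitary1.
have U1_unitary : V1 *m U *m O1^t* \is unitarymx.
  by rewrite !mul_unitarymx ?trmxC_unitary.
have [||X [J [X_unitary J_sym U1E]]] :=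
  unitary_diag_block_symmetry (delta := delta) U1_unitary.
- rewrite -svd -[in LHS](submxK U) block_mx_adj !trmx0 !map_mx0.
  by rewrite !mulmx_block block_mxKul !mul0mx !mulmx0 !addr0.
- by [].
(* From [V1 U O1^* = diag(1, X) J] follows [U = V1^* diag(1, X) O1 (O1^* J O1)], and the factor
   before the parenthesis is [diag(V^* O, X)]. *)
exists (V^t* *m O), X, (O1^t* *m J *m O1); split=> //.
- by rewrite mul_unitarymx ?trmxC_unitary.
- exact: symmetry_conj.
have -> : U = V1^t* *m (V1 *m U *m O1^t*) *m O1.
  rewrite !mulmxA (unitarymx_adjP V1_unitary) mul1mx -mulmxA.
  by rewrite (unitarymx_adjP O1_unitary) mulmx1.
rewrite U1E !mulmxA; congr (_ *m _ *m _).
rewrite !block_mx_adj !trmx0 !map_mx0 trmx1 map_mx1 !mulmx_block.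
rewrite !(mulmx0, mul0mx, mulmx1, mul1mx, addr0, add0r).
by rewrite -mulmxA (unitarymxP O_unitary) mulmx1.
Qed.

(** * Comparison of the two orbits *)

Lemma Sym2_orbit_sub n (T : 'M[C]_n) :
  (Sym2_orbit T `<=` unitary_orbit T)%classic.
Proof.
move=> _ [_ [J J_sym [K K_sym <-]] <-]; exists (J *m K) => //.
by apply: mul_unitarymx; apply: symmetry_unitary.
Qed.

(** A unitary [D] commuting with [T] satisfies [D^* T D = T], so it drops out of the conjugation by
    [U]. *)
Lemma unitary_orbit_eq_Sym2 n (T : 'M[C]_n) :
    (forall U, U \is unitarymx -> exists D J K, [/\ D \is unitarymx,
      comm_mx D T, symmetry J & symmetry K /\ U = D *m (J *m K)]) ->
  unitary_orbit T = Sym2_orbit T.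
Proof.
move=> factor; apply/seteqP; split; last exact: Sym2_orbit_sub.
move=> _ [U /factor[D [J [K [D_unitary DT J_sym [K_sym ->]]]]] <-].
exists (J *m K); first by exists J => //; exists K.
rewrite [(D *m _)^t*]mulmx_adj !mulmxA; congr (_ *m _ *m _).
rewrite -!mulmxA -DT; congr (_ *m _).
by rewrite mulmxA (unitarymx_adjP D_unitary) mul1mx.
Qed.

Lemma orbit_block_scalar p q r s (a b c e : C) :
  let T := block_mx (block_mx (a%:M : 'M_p) 0 0 (b%:M : 'M_q)) 0
                    0 (block_mx (c%:M : 'M_r) 0 0 (e%:M : 'M_s)) in
  unitary_orbit T = Sym2_orbit T.
Proof.
(* The outer splitting gives the last symmetry [L]; splitting each of the two diagonal blocks again
   gives [J] and [K]. *)
move=> T; apply: unitary_orbit_eq_Sym2 => U /unitary_block_diag_symmetry.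
case=> _ [_ [L [/unitary_block_diag_symmetry[A [B [J [A_u B_u J_sym ->]]]]
  /unitary_block_diag_symmetry[A' [B' [K [A'_u B'_u K_sym ->]]]] L_sym ->]]].
exists (block_mx (block_mx A 0 0 B) 0 0 (block_mx A' 0 0 B')).
exists (block_mx J 0 0 K), L; split.
- by rewrite !block_diag_unitary A_u B_u A'_u B'_u.
- rewrite /comm_mx !mulmx_block !mulmx0 !mul0mx !addr0 !add0r.
  by rewrite !scalar_mxC.
- exact: symmetry_block_diag.
- by split=> //; rewrite mulmxA mulmx_block !mulmx0 !mul0mx !addr0 !add0r.
Qed.

End Decomposition.

(** * From the block diagonal sum to nested blocks *)

Lemma mxdiag_scalar (R : pzSemiRingType) p (d : 'I_p -> nat) (lam : 'I_p -> R) :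
  \mxdiag_i ((lam i)%:M : 'M_(d i)) = diag_mx (\row_k lam (tagnat.sig1 k)).
Proof.
apply/matrixP => k l; rewrite !mxE.
(* Indices agree when block and offset agree; offsets are compared in [nat] since their type depends
   on the block. *)
have -> : (k == l) = (tagnat.sig1 k == tagnat.sig1 l) &&
    (tagnat.sig2 k == tagnat.sig2 l :> nat).
  by rewrite -tagnat.eq_Rank !tagnat.sig2K.
case: eqP => [e|_] /=; last by rewrite mxE.
move: (tagnat.sig2 k) (tagnat.sig2 l); rewrite -e => i j.
by rewrite conform_mx_id mxE.
Qed.

Lemma castmx_diag_mx (R : pzSemiRingType) m n (e : m = n) (a : 'rV[R]_m) :
  castmx (e, e) (diag_mx a) = diag_mx (castmx (erefl, e) a).
Proof. by case: n / e. Qed.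

(** Nested blocks have a size equal, but not convertible, to the sum of the [d i]. *)
Lemma orbit_castmx (C : numClosedFieldType) m n (e : m = n) (T : 'M[C]_m) :
  unitary_orbit T = Sym2_orbit T ->
  unitary_orbit (castmx (e, e) T) = Sym2_orbit (castmx (e, e) T).
Proof. by case: n / e. Qed.

Theorem proposition5p20 (R : realType) (d : 'I_4 -> nat) (lam : 'I_4 -> R[i])
    (d_ge1 : forall i, (1 <= d i)%N) (lam_distinct : injective lam)
    (T := \mxdiag_(i < 4) ((lam i)%:M : 'M[R[i]]_(d i))) :
  unitary_orbit T = Sym2_orbit T.
Proof.
(* These are the forms in which [big_ord_recl] lists the elements of ['I_4]. *)
pose i0 : 'I_4 := ord0; pose i1 : 'I_4 := lift ord0 ord0.
pose i2 : 'I_4 := lift ord0 (lift ord0 ord0).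
pose i3 : 'I_4 := lift ord0 (lift ord0 (lift ord0 ord0)).
have e : (d i0 + d i1 + (d i2 + d i3) = \sum_i d i)%N.
  by rewrite !big_ord_recl big_ord0 addn0 !addnA.
have TE : T = castmx (e, e)
    (block_mx (block_mx (lam i0)%:M 0 0 (lam i1)%:M) 0
              0 (block_mx (lam i2)%:M 0 0 (lam i3)%:M)).
  rewrite /T mxdiag_scalar -!diag_const_mx -!diag_mx_row castmx_diag_mx.
  congr diag_mx; apply/rowP => k; rewrite castmxE mxE cast_ord_id /=.
  rewrite -[in LHS](cast_ordKV e k); move: (cast_ord (esym e) k) => {k} k.
  (* The block of an index is determined by its rank as a natural number; the two nested splittings
     of [k] then leave four rank computations. *)
  have sig1E i (j : 'I_(d i)) : cast_ord e k = tagnat.Rank i j :> nat ->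
      tagnat.sig1 (cast_ord e k) = i.
    by move=> /val_inj ->; rewrite tagnat.Rank1K.
  case: (split_ordP k) => {}k' kE; case: (split_ordP k') => j k'E;
    rewrite {}k'E in kE; rewrite [in RHS]kE !(row_mxEl, row_mxEr) mxE;
    congr lam;
    [apply: (sig1E i0 j) | apply: (sig1E i1 j) | apply: (sig1E i2 j)
      | apply: (sig1E i3 j)];
    by rewrite tagnat.RankEsum kE /= !big_mkcond !big_ord_recl big_ord0 /=
      ?addn0 ?add0n ?addnA.
by rewrite TE; apply: orbit_castmx; apply: orbit_block_scalar.
Qed.
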